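(* Let $L$ be an effect algebra with the strong Riesz Decomposition Property and with a natural basis $(b_n)_{n\in\mathbb{N}}$, and let $X$ be a finite dimensional Banach space. If $\mu:L\to X$ is a $\sigma$-additive measure, then $\mu$ is bounded, i.e. $\sup\{\|\mu(a)\|:a\in L\}<+\infty$.
   Context: An effect algebra $(L,\oplus,0,1)$ is a set $L$ with elements $0,1\in L$ and a partial binary operation $\oplus$ such that for all $p,q,r\in L$: (E1) if $p\oplus q$ is defined then $q\oplus p$ is defined and equal to it; (E2) if $q\oplus r$ and $p\oplus(q\oplus r)$ are defined then $p\oplus q$ and $(p\oplus q)\oplus r$ are defined and $(p\oplus q)\oplus r=p\oplus(q\oplus r)$; (E3) for every $p$ there is a unique $q$ with $p\oplus q=1$; (E4) if $1\oplus p$ is defined then $p=0$. The partial order on $L$ is: $p\le q$ iff there is $r$ with $p\oplus r=q$. Elements $p,q$ are orthogonal if $p\oplus q$ is defined. Finite orthosums are defined inductively (independent of the order). A sequence $(a_n)_{n\in\mathbb{N}}$ in $L$ is orthogonal if for every finite set $F$ of indices $\bigoplus_{n\in F}a_n$ exists; $\bigoplus_{n\in\mathbb{N}}a_n$ denotes the supremum of $\{\bigoplus_{n\in F}a_n: F\subset\mathbb{N}\text{ finite}\}$ in $L$, if it exists. $L$ has the Riesz Decomposition Property (RDP) if $c\le a\oplus b$ implies $c=c_1\oplus c_2$ with $c_1\le a$, $c_2\le b$. $L$ has the strong Riesz Decomposition Property (sRDP) if moreover, whenever $(a_n)_{n\in\mathbb{N}}$ is orthogonal, $\bigoplus_{n}a_n$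 exists and $c\le\bigoplus_{n}a_n$, there is an orthogonal sequence $(c_n)$ with $c=\bigoplus_{n}c_n$ and $c_n\le a_n$ for all $n$. A natural basis of $L$ is an orthogonal sequence $(b_n)_{n\in\mathbb{N}}$ with $1=\bigoplus_{n\in\mathbb{N}}b_n$ and each $b_n$ minimal in $L\setminus\{0\}$. A measure is a map $\mu$ with $\mu(a\oplus b)=\mu(a)+\mu(b)$ for orthogonal $a,b$; it is $\sigma$-additive if $\mu(\bigoplus_{n}a_n)=\sum_{n}\mu(a_n)$ for every orthogonal sequence $(a_n)$ such that $\bigoplus_n a_n$ exists. *)

(* Defs.v *)
From HB Require Import structures.
From mathcomp Require Import all_boot all_order all_algebra finmap.
From mathcomp Require Import complex.
From mathcomp Require Import all_classical all_reals.
From mathcomp Require Import topology normedtype sequences.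

Set Implicit Arguments.
Unset Strict Implicit.
Unset Printing Implicit Defensive.

Import Order.TTheory GRing.Theory Num.Theory.
Import numFieldNormedType.Exports.

Local Open Scope classical_set_scope.
Local Open Scope ring_scope.

(* The partial operation is option-valued: None means "undefined". *)
Record effectAlgebra := EffectAlgebra {
  ea_sort :> Type;
  ea_zero : ea_sort;
  ea_one : ea_sort;
  oplus : ea_sort -> ea_sort -> option ea_sort;
  oplusC : forall p q s, oplus p q = Some s -> oplus q p = Some s;
  oplusA : forall p q r s t, oplus q r = Some s -> oplus p s = Some t ->
    exists2 u, oplus p q = Some u & oplus u r = Some t;
  oplus_compl : forall p, exists! q, oplus p q = Some ea_one;
  oplus_one : forall p s, oplus ea_one p = Some s -> p = ea_zero
}.

Arguments ea_zero {e}.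
Arguments ea_one {e}.

Section EffectAlgebraTheory.
Variable L : effectAlgebra.
Implicit Types (a b c : nat -> L) (x y p q s : L) (F : {fset nat}).

Definition ea_le p q := exists r, oplus p r = Some q.

(* Strict extension of oplus to possibly undefined arguments. *)
Definition oplus_opt (u v : option L) : option L :=
  obind (fun p => obind (oplus p) v) u.

Definition fin_orthosum a F : option L :=
  \big[oplus_opt/Some ea_zero]_(n <- F) Some (a n).

Definition orthogonal_seq a := forall F, exists s, fin_orthosum a F = Some s.

(* For an orthogonal sequence a: the orthosum of a exists and equals s. *)
Definition is_orthosum a s :=
  (forall F p, fin_orthosum a F = Some p -> ea_le p s) /\
  (forall q, (forall F p, fin_orthosum a F = Some p -> ea_le p q) -> ea_le s q).

Definition RDP := forall x y s p, oplus x y = Some s -> ea_le p s ->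
  exists p1 p2, [/\ oplus p1 p2 = Some p, ea_le p1 x & ea_le p2 y].

Definition sRDP := RDP /\
  forall a s p, orthogonal_seq a -> is_orthosum a s -> ea_le p s ->
  exists c, [/\ orthogonal_seq c, is_orthosum c p & forall n, ea_le (c n) (a n)].

Definition minimal_nonzero p :=
  p <> ea_zero /\ forall q, q <> ea_zero -> ea_le q p -> q = p.

Definition natural_basis b :=
  [/\ orthogonal_seq b, is_orthosum b ea_one & forall n, minimal_nonzero (b n)].

Section Measure.
Variables (K : numFieldType) (X : normedModType K).
Implicit Type mu : L -> X.

Definition is_measure mu :=
  forall p q s, oplus p q = Some s -> mu s = mu p + mu q.

Definition sigma_additive mu :=
  forall a s, orthogonal_seq a -> is_orthosum a s ->
  series (fun n => mu (a n)) @ \oo --> mu s.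

End Measure.

End EffectAlgebraTheory.

Definition finite_dimensional (K : numFieldType) (X : lmodType K) :=
  exists (d : nat) (e : 'I_d -> X),
    forall x, exists k : 'I_d -> K, x = \sum_(i < d) k i *: e i.

(* Banach spaces may be real or complex. *)
Variant scalar_kind := RealScalars | ComplexScalars.

Definition scalars (R : realType) (k : scalar_kind) : numFieldType :=
  match k with RealScalars => R | ComplexScalars => R[i] end.

(* Main.v *)
Require Import Defs.
From HB Require Import structures.
From mathcomp Require Import all_boot all_order all_algebra finmap zify.
From mathcomp Require Import all_classical all_reals.
From mathcomp Require Import topology normedtype sequences.

(** By sRDP and minimality of the [b n], every element of [L] is the orthosum
    of a subfamily of [b], so [mu a] is a limit of finite sums of the vectors
    [mu (b n)], and it suffices to bound those finite sums.  If they were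
    unbounded, there would be consecutive intervals partitioning [nat], each
    containing a finite set with a sum of norm larger than 1.  Splitting every
    interval into this set and its complement regroups [b] into an orthogonal
    sequence that still has orthosum 1, so by sigma-additivity the block sums
    are the terms of a convergent series and tend to 0: a contradiction. *)

Set Implicit Arguments.
Unset Strict Implicit.

Import Order.TTheory GRing.Theory Num.Theory.
Import numFieldNormedType.Exports.

Local Open Scope classical_set_scope.
Local Open Scope fset_scope.
Local Open Scope ring_scope.

Section EffectAlgebra.
Variable L : effectAlgebra.
Implicit Types (p q r s : L) (a b : nat -> L).

Lemma oplus_comm p q : oplus p q = oplus q p.
Proof.
case E: (oplus p q) => [s|]; first by rewrite (oplusC E).
by case E': (oplus q p) => [s|//]; rewrite (oplusC E') in E.
Qed.

(** By (E4) the complement of 1 is 0. If [q] is the complement of [p], then (E2) applied to 0, [p],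
    [q] makes 0 + p another complement of [q], and complements are unique. *)
Lemma oplus0p p : oplus ea_zero p = Some p.
Proof.
have one0 : oplus ea_one (ea_zero : L) = Some ea_one.
  by have [q [h _]] := @oplus_compl L ea_one; rewrite -{1}(oplus_one h).
have [q [pq _]] := oplus_compl p.
have [w -> wq] := oplusA pq (oplusC one0).
have [v [_ vuniq]] := oplus_compl q.
by rewrite -(vuniq _ (oplusC wq)) (vuniq _ (oplusC pq)).
Qed.

Lemma oplus_optC : commutative (@oplus_opt L).
Proof. by move=> [p|] [q|] //=; exact: oplus_comm. Qed.

Lemma oplus_optA : associative (@oplus_opt L).
Proof.
move=> [p|] [q|] [r|] //=; last by case: (oplus p q).
case Eqr: (oplus q r) => [s|] /=.
  case Eps: (oplus p s) => [t|].
    by have [u -> /= ->] := oplusA Eqr Eps.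
  case Epq: (oplus p q) => [u|] //=.
  case Eur: (oplus u r) => [t|] //.
  (* (E2) transfers definedness in one direction only; the other comes from commuting both sums
     first. *)
  have [v] := oplusA (oplusC Epq) (oplusC Eur).
  by rewrite oplus_comm Eqr => -[<-] /oplusC; rewrite Eps.
case Epq: (oplus p q) => [u|] //=.
case Eur: (oplus u r) => [t|] //.
by have [v] := oplusA (oplusC Epq) (oplusC Eur); rewrite oplus_comm Eqr.
Qed.

Lemma oplus_opt0 : left_id (Some ea_zero) (@oplus_opt L).
Proof. by move=> [p|] //=; exact: oplus0p. Qed.

(** With [None] absorbing, the partial sum is a total commutative monoid law, so big-operator lemmas
    apply to finite orthosums. *)
HB.instance Definition _ := Monoid.isComLaw.Build (option L) (Some ea_zero)
  (@oplus_opt L) oplus_optA oplus_optC oplus_opt0.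

Lemma ea_le_trans p q r : ea_le p q -> ea_le q r -> ea_le p r.
Proof.
move=> [x px] [y qy].
have [u _ up] := oplusA (oplusC px) (oplusC qy).
by exists u; exact: oplusC.
Qed.

Lemma fin_orthosum_sub a (F G : {fset nat}) p q : F `<=` G ->
  fin_orthosum a F = Some p -> fin_orthosum a G = Some q -> ea_le p q.
Proof.
move=> FG Fp; rewrite /fin_orthosum (big_fsetID _ (mem F)) /=.
have -> : [fset x | x in G & mem F x] = F.
  by apply/fsetP => n; rewrite !inE /= andb_idl// => /(fsubsetP FG).
rewrite -/(fin_orthosum a F) Fp; case: (\big[_/_]_(_ <- _) _) => //= r pr.
by exists r.
Qed.

Lemma fin_orthosum_regroup a b (F : nat -> {fset nat}) (G : {fset nat}) :
  (forall i j, i != j -> [disjoint F i & F j]) ->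
  (forall k, fin_orthosum b (F k) = Some (a k)) ->
  fin_orthosum a G = fin_orthosum b (\bigcup_(k <- G) F k).
Proof.
move=> dF Fa; rewrite /fin_orthosum partition_disjoint_bigfcup.
  by apply: eq_bigr => k _; rewrite -Fa.
by move=> i j _ _; exact: dF.
Qed.

(** Finite sums of [a] are sums of [b] over finite unions of blocks, and every finite index set lies
    in such a union; hence both families of finite sums have the same upper bounds. *)
Lemma orthosum_regroup a b (F : nat -> {fset nat}) s :
  (forall i j, i != j -> [disjoint F i & F j]) ->
  (forall n, exists k, n \in F k) ->
  (forall k, fin_orthosum b (F k) = Some (a k)) ->
  orthogonal_seq b -> is_orthosum b s -> orthogonal_seq a /\ is_orthosum a s.
Proof.
move=> dF cF Fa ob [bs sb]; have regroup G := fin_orthosum_regroup G dF Fa.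
split; first by move=> G; rewrite regroup; exact: ob.
split; first by move=> G p; rewrite regroup; exact: bs.
move=> q aq; apply: sb => H p Hp.
have [c cP] := boolp.choice cF.
have [p' Gp'] := ob (\bigcup_(k <- [fset c n | n in H]) F k).
apply: (@ea_le_trans _ p'); last first.
  by apply: (aq [fset c n | n in H]); rewrite regroup.
apply: fin_orthosum_sub Hp Gp'; apply/fsubsetP => n nH.
by apply/bigfcupP; exists (c n); rewrite ?andbT// in_imfset.
Qed.

Section Measure.
Variables (K : numFieldType) (X : normedModType K) (mu : L -> X).
Hypothesis hmu : is_measure mu.

Lemma measure0 : mu ea_zero = 0.
Proof.
by have /eqP := hmu (oplus0p ea_zero); rewrite -[X in X == _]addr0 => /eqP/addrI.
Qed.

Lemma measure_fin_orthosum a (F : {fset nat}) s :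
  fin_orthosum a F = Some s -> mu s = \sum_(n <- F) mu (a n).
Proof.
rewrite /fin_orthosum; elim: (enum_fset F) s => [|n t IH] s.
  by rewrite !big_nil => -[<-]; exact: measure0.
rewrite !big_cons; case E: (\big[_/_]_(_ <- _) _) => [r|] //= nr.
by rewrite (hmu nr) (IH _ E).
Qed.

End Measure.
End EffectAlgebra.

Lemma strictly_increasing_cover (N : nat -> nat) :
  N 0%N = 0%N -> (forall k, (N k < N k.+1)%N) ->
  forall n, exists k, (N k <= n < N k.+1)%N.
Proof.
move=> N0 NS; elim=> [|n [k /andP[kn nk]]].
  by exists 0%N; rewrite N0 -[X in (X < _)%N]N0 NS.
have [nk'|nk'] := ltnP n.+1 (N k.+1); first by exists k; rewrite nk' ltnW.
by exists k.+1; rewrite nk'; have := NS k.+1; lia.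
Qed.

Section UnconditionalSums.
Variables (K : numFieldType) (X : normedModType K) (x : nat -> X).

(** Otherwise any finite sum would be at most the sum of the norms of the first [N] terms, plus 1
    for the rest. *)
Lemma unbounded_sums_tail :
  ~ (exists M : K, forall F : {fset nat}, `|\sum_(n <- F) x n| <= M) ->
  forall N : nat, exists B : {fset nat},
    (forall n, n \in B -> (N <= n)%N) /\ ~ `|\sum_(n <- B) x n| <= 1.
Proof.
move=> unb N; apply: contrapT => small; apply: unb.
pose I := [fset n in iota 0 N].
exists (\sum_(n <- I) `|x n| + 1) => F.
rewrite (big_fsetID _ (fun n => (n < N)%N)) /=.
apply: le_trans (ler_normD _ _) _; apply: lerD; last first.
  apply: contrapT => big; apply: small; exists [fset n in F | ~~ (n < N)%N].
  by split=> // n; rewrite !inE /= -leqNgt => /andP[].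
apply: le_trans (ler_norm_sum _ _ _) _.
rewrite [leRHS](big_fsetID _ (mem F)) /=.
have -> : [fset n in F | (n < N)%N] = [fset n in I | mem F n].
  by apply/fsetP => n; rewrite !inE /= mem_iota andbC.
by rewrite lerDl sumr_ge0.
Qed.

Lemma bounded_sums_of_vanishing_blocks :
  (forall F : nat -> {fset nat},
    (forall i j, i != j -> [disjoint F i & F j]) ->
    (forall n, exists k, n \in F k) ->
    (fun k => \sum_(n <- F k) x n) @ \oo --> (0 : X)) ->
  exists M : K, forall F : {fset nat}, `|\sum_(n <- F) x n| <= M.
Proof.
move=> vanish; apply: contrapT => unb.
have step (N : nat) : exists p : {fset nat} * nat,
    [/\ (N < p.2)%N, (forall n, n \in p.1 -> (N <= n < p.2)%N) &
        ~ `|\sum_(n <- p.1) x n| <= 1].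
  have [B [NB big]] := unbounded_sums_tail unb N.
  (* The sum of all elements of [B] is a crude upper bound for each of them; the successor makes
     both bounds strict. *)
  exists (B, (N + \sum_(n <- B) n).+1%N); split=> //=; first by lia.
  move=> n nB; rewrite NB//= (big_fsetD1 n)//=; lia.
have [g gP] := boolp.choice step.
pose N k := iter k (fun m => (g m).2) 0%N.
pose B k := (g (N k)).1.
have NS k : (N k < N k.+1)%N by have [] := gP (N k).
have BN k n : n \in B k -> (N k <= n < N k.+1)%N by have [_ /(_ n)] := gP (N k).
have Nmono : {homo N : i j / (i <= j)%N}.
  by apply: homo_leq => [//|i j k|i]; [exact: leq_trans|exact: ltnW].
(* Block [2k] is [B k] and block [2k+1] is its complement in the interval from [N k] to [N k.+1], so
   the blocks partition [nat]. *)
pose F j :=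
  if odd j then
    [fset n in iota (N j./2) (N j./2.+1 - N j./2) | n \notin B j./2]
  else B j./2.
have FN j n : n \in F j -> (N j./2 <= n < N j./2.+1)%N.
  rewrite /F; case: ifP => _; last exact: BN.
  by rewrite !inE /= mem_iota; have := NS j./2; lia.
have F_half i j n : n \in F i -> n \in F j -> (i./2 <= j./2)%N.
  move=> /FN ni /FN nj; rewrite leqNgt; apply/negP => /Nmono; lia.
have dF i j : i != j -> [disjoint F i & F j].
  move=> ij; apply/fdisjointP => n nFi; apply/negP => nFj.
  have eqh : i./2 = j./2 by apply/eqP; rewrite eqn_leq !(F_half _ _ n).
  have {ij} : odd i != odd j by lia.
  move: nFi nFj; rewrite /F eqh.
  by case: (odd i); case: (odd j) => //=; rewrite !inE /=;
    case: (n \in B j./2); rewrite ?andbF.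
have cF n : exists k, n \in F k.
  have [k kn] := strictly_increasing_cover (erefl : N 0%N = 0%N) NS n.
  have [nB|nB] := boolP (n \in B k).
    by exists k.*2; rewrite /F odd_double doubleK.
  exists k.*2.+1; rewrite /F /= odd_double /= uphalf_double !inE /= nB mem_iota.
  by rewrite andbT subnKC ?(ltnW (NS k)).
(* Block [2m] has index at least [m], so its sum has norm below 1, although it is the large block
   [B m]. *)
have /cvgr0_norm_lt/(_ 1 ltr01)[m _ mP] := vanish F dF cF.
have [_ _] := gP (N m); apply; apply/ltW.
have := mP m.*2; rewrite /F odd_double doubleK; apply.
by rewrite /= -addnn leq_addr.
Qed.

End UnconditionalSums.

Section NaturalBasis.
Variables (L : effectAlgebra) (b : nat -> L).
Variables (K : numFieldType) (X : normedModType K) (mu : L -> X).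
Hypotheses (hL : sRDP L) (hb : natural_basis b).
Hypotheses (hmu : is_measure mu) (hsigma : sigma_additive mu).

Lemma natural_basis_sums_bounded :
  exists M : K, forall F : {fset nat}, `|\sum_(n <- F) mu (b n)| <= M.
Proof.
have [ob b1 _] := hb.
apply: bounded_sums_of_vanishing_blocks => F dF cF.
have [a Fa] := boolp.choice (fun k => ob (F k)).
have [oa a1] := orthosum_regroup dF cF Fa ob b1.
under eq_fun do rewrite -(measure_fin_orthosum hmu (Fa _)).
apply: cvg_series_cvg_0; apply/cvg_ex; exists (mu ea_one); exact: hsigma.
Qed.

Lemma natural_basis_measure_bounded : exists M : K, forall p : L, `|mu p| <= M.
Proof.
have [M MP] := natural_basis_sums_bounded; exists (1 + M) => p.
have [ob b1 minb] := hb.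
have p1 : ea_le p ea_one.
  by have [q [pq _]] := oplus_compl p; exists q.
have [c [oc cp cb]] := hL.2 b ea_one p ob b1 p1.
(* Minimality of [b n] leaves only 0 and [b n] as values of [c n]. *)
have muc n : mu (c n) = if `[< c n = ea_zero >] then 0 else mu (b n).
  case: asboolP => [->|cn0]; first exact: measure0.
  by have [_ /(_ _ cn0 (cb n)) ->] := minb n.
have /cvgrPdist_lt/(_ 1 ltr01)[m _ mP] := hsigma oc cp.
(* The remainder after [m] terms costs the 1 in [1 + M]; the partial sum is a finite sum of basis
   values, bounded by [M]. *)
rewrite -(subrK (series (fun n => mu (c n)) m) (mu p)).
apply: le_trans (ler_normD _ _) _; apply: lerD; first exact/ltW/mP/leqnn.
have -> : series (fun n => mu (c n)) m =
    \sum_(n <- [fset n in iota 0 m | ~~ `[< c n = ea_zero >]]) mu (b n).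
  rewrite big_fset /= /series /=.
  under eq_bigr do rewrite muc -if_neg.
  by rewrite -big_mkcond /= /index_iota subn0 undup_id ?iota_uniq.
exact: MP.
Qed.

End NaturalBasis.

Theorem theorem2p9 (R : realType) (k : scalar_kind)
    (X : completeNormedModType (scalars R k)) (hX : finite_dimensional X)
    (L : effectAlgebra) (hL : sRDP L)
    (b : nat -> L) (hb : natural_basis b)
    (mu : L -> X) (hmu : is_measure mu) (hsigma : sigma_additive mu) :
  exists M : scalars R k, forall a : L, `|mu a| <= M.
Proof. exact: natural_basis_measure_bounded hL hb hmu hsigma. Qed.
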